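(* Let $D$ be a strong semicomplete multipartite digraph with $n$ vertices. If $d(u)+d(v)\geq 2n-3$ for every pair of dominated nonadjacent vertices $\{u,v\}$ of $D$, then $D$ is supereulerian.
   Context: All digraphs are finite, loopless and without parallel arcs (a pair of opposite arcs $(x,y),(y,x)$ is allowed). $(w,z)$ denotes an arc from $w$ to $z$. For a vertex $x$, $d(x)=d^-(x)+d^+(x)$ is the sum of its in-degree and out-degree. Two distinct vertices $u,v$ are nonadjacent if neither $(u,v)$ nor $(v,u)$ is an arc. A pair $\{u,v\}$ is dominated if there is a vertex $w$ with $(w,u),(w,v)\in A(D)$. A digraph is strong if every vertex is reachable from every other vertex by a directed path. A digraph is supereulerian if it contains a closed directed trail (a closed walk with no repeated arcs) passing through every vertex, i.e. it has a spanning eulerian subdigraph. A semicomplete multipartite digraph is a biorientation of a complete multipartite graph, i.e. it is obtained from a complete multipartite graph by replacing each edge $xy$ by $(x,y)$, by $(y,x)$, or by both arcs. *)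

(* Defs.v *)
(* A digraph on the finite vertex set T is given by its arc
   relation D : rel T, so there are no parallel arcs; looplessness is
   irreflexive D. *)
From mathcomp Require Export all_boot.

Set Implicit Arguments.
Unset Strict Implicit.
Unset Printing Implicit Defensive.

Definition indeg (T : finType) (D : rel T) (x : T) : nat := #|[set y | D y x]|.

Definition outdeg (T : finType) (D : rel T) (x : T) : nat := #|[set y | D x y]|.

Definition deg (T : finType) (D : rel T) (x : T) : nat :=
  indeg D x + outdeg D x.

Definition nonadjacent (T : finType) (D : rel T) (u v : T) : Prop :=
  [/\ u != v, ~~ D u v & ~~ D v u].

Definition dominated (T : finType) (D : rel T) (u v : T) : Prop :=
  exists w : T, D w u /\ D w v.

Definition strong (T : finType) (D : rel T) : Prop :=
  forall x y : T, connect D x y.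

Definition complete_multipartite (T : finType) (G : rel T) : Prop :=
  exists P : {set {set T}},
    partition P [set: T] /\ forall x y : T, G x y = (pblock P x != pblock P y).

Definition biorientation (T : finType) (G D : rel T) : Prop :=
  forall x y : T, D x y || D y x = G x y.

Definition semicomplete_multipartite (T : finType) (D : rel T) : Prop :=
  exists G : rel T, complete_multipartite G /\ biorientation G D.

(* The walk x, p_1, ..., p_k is encoded by its first vertex x and the sequence
   p of the following ones; p = [::] is the trivial walk, without arcs. *)
Definition walk_arcs (T : finType) (x : T) (p : seq T) : seq (T * T) :=
  zip (belast x p) p.

Definition closed_trail (T : finType) (D : rel T) (x : T) (p : seq T) : Prop :=
  [/\ path D x p, last x p = x & uniq (walk_arcs x p)].

Definition supereulerian (T : finType) (D : rel T) : Prop :=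
  exists (x : T) (p : seq T),
    closed_trail D x p /\ forall v : T, v \in x :: p.

(* Main.v *)
Require Import Defs.
From mathcomp Require Import zify.

(* A spanning balanced subdigraph with no isolated vertex (eulerian factor) exists
   by Hoffman's circulation argument: for a balanced F covering as many vertices
   as possible, an uncovered v yields either an augmenting cycle in the residual
   network or a cut crossed by few arcs. The vertices B split by the cut then all
   lie in the part of v, and the degree condition together with strong
   connectivity rules the cut out.

   An eulerian factor with the largest connectivity relation is connected. No
   cycle of D can consist of arcs between components, and no arc of a component
   can be rerouted through another one, nor can arcs of two components be
   swapped. In a multipartite digraph this forces, for any two components, all
   arcs between them to have the same direction, so by strong connectivity every
   vertex has an arc to another component; such arcs contain a cycle. *)

Set Implicit Arguments.
Unset Strict Implicit.
Unset Printing Implicit Defensive.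

(** * Arc sets: degrees, balance and exchange of arcs *)

Definition arc (T : finType) (F : {set T * T}) : rel T :=
  fun x y => (x, y) \in F.

Arguments arc T F x y /.

Definition balanced (T : finType) (F : {set T * T}) : bool :=
  [forall x, outdeg (arc F) x == indeg (arc F) x].

Lemma outdegE (T : finType) (F : {set T * T}) x :
  outdeg (arc F) x = \sum_y ((x, y) \in F).
Proof.
rewrite /outdeg -sum1_card big_mkcond /=.
by apply: eq_bigr => y _; rewrite inE /=; case: (_ \in F).
Qed.

Lemma indegE (T : finType) (F : {set T * T}) x :
  indeg (arc F) x = \sum_y ((y, x) \in F).
Proof.
rewrite /indeg -sum1_card big_mkcond /=.
by apply: eq_bigr => y _; rewrite inE /=; case: (_ \in F).
Qed.

Lemma outdeg_gt0 (T : finType) (F : {set T * T}) x y :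
  (x, y) \in F -> 0 < outdeg (arc F) x.
Proof. by move=> xy; apply/card_gt0P; exists y; rewrite inE. Qed.

Lemma indeg_gt0 (T : finType) (F : {set T * T}) x y :
  (x, y) \in F -> 0 < indeg (arc F) y.
Proof. by move=> xy; apply/card_gt0P; exists x; rewrite inE. Qed.

(** [M] is removed and [P] inserted; the additive form avoids truncated subtraction. *)
Lemma mem_update (T : finType) (F M P : {set T * T}) a :
  M \subset F -> [disjoint P & F] ->
  (a \in F :\: M :|: P) + (a \in M) = (a \in F) + (a \in P).
Proof.
move=> /subsetP/(_ a) MF; rewrite disjoint_subset => /subsetP/(_ a).
rewrite !inE; case: (a \in M) MF => [->//|_]; case: (a \in P) => [/(_ isT)|_].
all: by case: (a \in F).
Qed.

Lemma outdeg_update (T : finType) (F M P : {set T * T}) x :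
  M \subset F -> [disjoint P & F] ->
  outdeg (arc (F :\: M :|: P)) x + outdeg (arc M) x =
  outdeg (arc F) x + outdeg (arc P) x.
Proof.
move=> MF PF; rewrite !outdegE -!big_split /=.
by apply: eq_bigr => y _; apply: mem_update.
Qed.

Lemma indeg_update (T : finType) (F M P : {set T * T}) x :
  M \subset F -> [disjoint P & F] ->
  indeg (arc (F :\: M :|: P)) x + indeg (arc M) x =
  indeg (arc F) x + indeg (arc P) x.
Proof.
move=> MF PF; rewrite !indegE -!big_split /=.
by apply: eq_bigr => y _; apply: mem_update.
Qed.

(** The equation says that the inserted arcs and the reversed removed arcs together are balanced at
    each vertex. *)
Lemma balanced_update (T : finType) (F M P : {set T * T}) :
  M \subset F -> [disjoint P & F] -> balanced F ->
  (forall x, outdeg (arc P) x + indeg (arc M) x =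
             indeg (arc P) x + outdeg (arc M) x) ->
  balanced (F :\: M :|: P).
Proof.
move=> MF PF /forallP bF e; apply/forallP => x; apply/eqP.
move: (outdeg_update x MF PF) (indeg_update x MF PF) (e x) (eqP (bF x)); lia.
Qed.

Lemma sum_outdeg (T : finType) (F : {set T * T}) (R : {set T}) :
  \sum_(x in R) outdeg (arc F) x = #|[set a in F | a.1 \in R]|.
Proof.
under eq_bigr do rewrite outdegE.
rewrite pair_big_dep -sum1_card big_mkcond [RHS]big_mkcond.
apply: eq_bigr => -[x y] _; rewrite !inE /= andbT.
by case: (x \in R); case: ((x, y) \in F).
Qed.

Lemma sum_indeg (T : finType) (F : {set T * T}) (R : {set T}) :
  \sum_(x in R) indeg (arc F) x = #|[set a in F | a.2 \in R]|.
Proof.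
under eq_bigr do rewrite indegE.
rewrite pair_big_dep -sum1_card (reindex (fun a : T * T => (a.2, a.1))) /=; last first.
  by exists (fun a : T * T => (a.2, a.1)) => -[].
rewrite big_mkcond [RHS]big_mkcond.
apply: eq_bigr => -[x y] _; rewrite !inE /= andbT.
by case: (y \in R); case: ((x, y) \in F).
Qed.

(* Balance forces as many arcs out of the set reachable from [y] as into it. *)
Lemma balanced_connect_sym (T : finType) (F : {set T * T}) :
  balanced F -> connect_sym (arc F).
Proof.
move=> /forallP bF.
suff rev x y : connect (arc F) x y -> connect (arc F) y x.
  by move=> x y; apply/idP/idP; apply: rev.
have step u w : (u, w) \in F -> connect (arc F) w u.
  move=> uw; apply: contraT => nwu; pose R := [set z | connect (arc F) w z].
  have: \sum_(x in R) outdeg (arc F) x = \sum_(x in R) indeg (arc F) x.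
    by apply: eq_bigr => z _; apply/eqP.
  rewrite sum_outdeg sum_indeg => e.
  suff: [set a in F | a.1 \in R] \proper [set a in F | a.2 \in R].
    by move=> /proper_card; rewrite e ltnn.
  apply/properP; split.
    apply/subsetP => -[a b]; rewrite !inE /= => /andP[ab wa].
    by rewrite ab (connect_trans wa) // connect1.
  by exists (u, w); rewrite !inE uw //= (negbTE nwu).
case/connectP=> p; elim: p x => [|z p IH] x /=; first by move=> _ ->.
move=> /andP[xz pz] yl; apply: connect_trans (IH _ pz yl) _; exact: step.
Qed.

Lemma connect_exit (T : finType) (e : rel T) (S : pred T) x y :
  connect e x y -> S x -> ~~ S y -> exists a b, [/\ S a, ~~ S b & e a b].
Proof.
case/connectP=> p; elim: p x => [|b p IH] a /=; first by move=> _ -> ->.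
case/andP=> ab pb yl Sa Sy; case: (boolP (S b)) => Sb; first exact: IH pb yl Sb Sy.
by exists a, b.
Qed.

(** * Closed trails in balanced arc sets *)

Lemma walk_arcs_cat (T : finType) (x : T) p q :
  walk_arcs x (p ++ q) = walk_arcs x p ++ walk_arcs (last x p) q.
Proof. by rewrite /walk_arcs belast_cat zip_cat ?size_belast. Qed.

Lemma mem_walk_arcs (T : finType) (e : rel T) (x : T) p a :
  path e x p -> a \in walk_arcs x p -> [/\ e a.1 a.2, a.1 \in x :: p & a.2 \in p].
Proof.
elim: p x => // z p IH x /= /andP[xz pz].
rewrite /walk_arcs /= inE => /predU1P[->/=|]; first by rewrite !mem_head.
by case/(IH _ pz) => ? h1 h2; split=> //; rewrite inE ?h1 ?h2 orbT.
Qed.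

Lemma walk_arcs_uniq (T : finType) (x : T) p : uniq p -> uniq (walk_arcs x p).
Proof.
move=> up; apply: (@map_uniq _ _ snd).
by rewrite -/unzip2 unzip2_zip // size_belast.
Qed.

(** The tails form [belast x p], the heads [p]; as the walk returns to [x], these lists are
    rearrangements of each other. Since no arc repeats, degrees are multiplicities in them. *)
Lemma closed_walk_arcs_balanced (T : finType) (x : T) p :
  last x p = x -> uniq (walk_arcs x p) ->
  forall z, outdeg (arc [set a in walk_arcs x p]) z =
            indeg (arc [set a in walk_arcs x p]) z.
Proof.
move=> lx us z; set s := walk_arcs x p in us *.
have cnt (f : T * T -> T) : #|[set a in s | f a == z]| = count_mem z (map f s).
  rewrite count_map -size_filter -(card_uniqP _) ?filter_uniq //.
  by apply: eq_card => a; rewrite !inE mem_filter andbC.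
have E1 : outdeg (arc [set a in s]) z = #|[set a in s | a.1 == z]|.
  rewrite -[LHS](big_set1 addn) sum_outdeg.
  by apply: eq_card => a; rewrite !inE.
have E2 : indeg (arc [set a in s]) z = #|[set a in s | a.2 == z]|.
  rewrite -[LHS](big_set1 addn) sum_indeg.
  by apply: eq_card => a; rewrite !inE.
rewrite E1 E2 !cnt -/unzip1 -/unzip2 unzip1_zip ?unzip2_zip ?size_belast //.
have: count_mem z (x :: p) = count_mem z (rcons (belast x p) (last x p)).
  by rewrite -lastI.
rewrite lx -cats1 count_cat /=; lia.
Qed.

(** Hierholzer's step: some arc [(a, b)] of [F] leaves the vertices of the trail. Without the arcs
    of the trail [F] stays balanced, so [b] still leads back to [a], and this detour is spliced in
    at [a]. *)
Lemma closed_trail_extend (T : finType) (F : {set T * T}) (x : T) p v :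
  balanced F -> (forall y z, connect (arc F) y z) ->
  closed_trail (arc F) x p -> v \notin x :: p ->
  exists q, closed_trail (arc F) x q /\ size p < size q.
Proof.
move=> bF cF [px lx us] vp.
have [a [b [ap bp ab]]] :
    exists a b, [/\ a \in x :: p, b \notin x :: p & (a, b) \in F].
  exact: (@connect_exit _ _ (mem (x :: p)) _ _ (cF x v) (mem_head _ _) vp).
pose M := [set a in walk_arcs x p]; pose G := F :\: M :|: set0.
have bG : balanced G.
  apply: balanced_update => //; last 1 first.
  - move=> z; rewrite (closed_walk_arcs_balanced lx us z) outdegE [X in _ = X + _]indegE.
    by rewrite !big1 // => y _; rewrite inE.
  - by apply/subsetP=> -[c d]; rewrite inE => /(mem_walk_arcs px)[].
  - by rewrite -setI_eq0 set0I.
have GE c : (c \in G) = (c \notin walk_arcs x p) && (c \in F).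
  by rewrite !inE orbF.
have abG : (a, b) \in G.
  rewrite GE ab andbT; apply: contra bp => /(mem_walk_arcs px)[_ _ /= h].
  by rewrite inE h orbT.
have : connect (arc G) b a by rewrite balanced_connect_sym // connect1.
case/connectP=> q0 pq0 lq0; case/shortenP: pq0 lq0 => q pq uq _ lq.
have [p1 [p2 [pE la]]] : exists p1 p2, p = p1 ++ p2 /\ last x p1 = a.
  by case/splitPl: ap => p1 p2 la; exists p1, p2.
exists (p1 ++ (b :: q) ++ p2); split; last first.
  by rewrite pE !size_cat ltn_add2l /= addSn ltnS leq_addl.
have subG : subrel (arc G) (arc F) by move=> c d /=; rewrite GE => /andP[].
have pb : path (arc G) a (b :: q) by rewrite /= abG.
have lb : last a (b :: q) = a by [].
move: px lx us GE; rewrite pE cat_path last_cat la !walk_arcs_cat la.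
move=> /andP[px1 px2] lx us GE; split.
- by rewrite cat_path la px1 cat_path (sub_path subG pb) lb px2.
- by rewrite !last_cat la lb lx.
- rewrite !walk_arcs_cat la lb uniq_catCA cat_uniq us walk_arcs_uniq // andbT.
  apply/hasPn => c cs; apply/negP => /= /(mem_walk_arcs pb)[].
  by rewrite /= -surjective_pairing GE cs.
Qed.

Lemma balanced_connected_trail (T : finType) (F : {set T * T}) (x : T) :
  balanced F -> (forall y z, connect (arc F) y z) ->
  exists p, closed_trail (arc F) x p /\ forall v, v \in x :: p.
Proof.
move=> bF cF.
(* [k] bounds the number of arcs that the trail may still gain. *)
suff H k p : closed_trail (arc F) x p -> #|F| <= k + size p ->
    exists p, closed_trail (arc F) x p /\ forall v, v \in x :: p.
  by apply: (H #|F| [::]) => //=; rewrite addn0.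
elim: k p => [|k IH] p tp hk.
all: case: (boolP [forall v, v \in x :: p]) => [/forallP ?|/forallPn[v vp]]; first by exists p.
all: have [q [tq sq]] := closed_trail_extend bF cF tp vp.
  have [pq _ uq] := tq.
  have : size (walk_arcs x q) <= #|F|.
    rewrite -(card_uniqP uq); apply: subset_leq_card; apply/subsetP => -[c d].
    by case/(mem_walk_arcs pq).
  rewrite /walk_arcs size_zip size_belast; lia.
by apply: IH tq _; lia.
Qed.

(** * Degrees in sets of one or two arcs, for the exchanges below *)

Lemma outdeg_set1 (T : finType) (a : T * T) z :
  outdeg (arc [set a]) z = (a.1 == z).
Proof.
case: a => a1 a2; rewrite outdegE (bigD1 a2) //= big1 => [|y ya].
  by rewrite !inE xpair_eqE eqxx andbT addn0 eq_sym.
by rewrite !inE xpair_eqE (negbTE ya) andbF.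
Qed.

Lemma indeg_set1 (T : finType) (a : T * T) z :
  indeg (arc [set a]) z = (a.2 == z).
Proof.
case: a => a1 a2; rewrite indegE (bigD1 a1) //= big1 => [|y ya].
  by rewrite !inE xpair_eqE eqxx addn0 eq_sym.
by rewrite !inE xpair_eqE (negbTE ya).
Qed.

Lemma outdeg_set2 (T : finType) (a b : T * T) z : a != b ->
  outdeg (arc [set a; b]) z = (a.1 == z) + (b.1 == z).
Proof.
move=> ab; rewrite -[LHS]addn0 -[X in _ + X](_ : outdeg (arc set0) z = 0); last first.
  by rewrite outdegE big1 // => y _; rewrite inE.
have dab : [disjoint [set b] & [set a]] by rewrite disjoints1 inE eq_sym.
by rewrite -[in LHS](setD0 [set a]) outdeg_update ?sub0set // !outdeg_set1.
Qed.

Lemma indeg_set2 (T : finType) (a b : T * T) z : a != b ->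
  indeg (arc [set a; b]) z = (a.2 == z) + (b.2 == z).
Proof.
move=> ab; rewrite -[LHS]addn0 -[X in _ + X](_ : indeg (arc set0) z = 0); last first.
  by rewrite indegE big1 // => y _; rewrite inE.
have dab : [disjoint [set b] & [set a]] by rewrite disjoints1 inE eq_sym.
by rewrite -[in LHS](setD0 [set a]) indeg_update ?sub0set // !indeg_set1.
Qed.

(** * Eulerian factors of largest connectivity *)

Definition eulerian_factor (T : finType) (D : rel T) (F : {set T * T}) : bool :=
  [&& F \subset [set a | D a.1 a.2], balanced F &
      [forall x, 0 < outdeg (arc F) x]].

(** Maximality is for inclusion of connectivity relations: an exchange that keeps all connections
    cannot create a new one. *)
Definition max_connected (T : finType) (D : rel T) (F : {set T * T}) : Prop :=
  forall F', eulerian_factor D F' ->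
    subrel (connect (arc F)) (connect (arc F')) ->
    subrel (connect (arc F')) (connect (arc F)).

(** A factor with the most connected pairs is maximal for inclusion. *)
Lemma max_connected_exists (T : finType) (D : rel T) :
  (exists F, eulerian_factor D F) ->
  exists2 F, eulerian_factor D F & max_connected D F.
Proof.
case=> F0 hF0; pose pairs (F : {set T * T}) := [set a | connect (arc F) a.1 a.2].
case: (arg_maxnP (fun F => #|pairs F|) hF0) => F hF Fmax.
exists F => // F' hF' sub x y xy.
have /eqP e : pairs F == pairs F'.
  rewrite eqEcard (Fmax _ hF' : _ <= _) andbT; by apply/subsetP => -[a b]; rewrite !inE; apply: sub.
have: (x, y) \in pairs F' by rewrite inE.
by rewrite -e inE.
Qed.

(** * Components of a maximal factor; [col] gives the part of a vertex *)

Section Merge.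
Variables (T : finType) (D : rel T) (col : T -> {set T}).
Hypothesis adjE : forall x y, D x y || D y x = (col x != col y).
Variable F : {set T * T}.
Hypothesis Ffac : eulerian_factor D F.
Hypothesis Fmax : max_connected D F.

Local Notation "x ~~> y" := (connect (arc F) x y) (at level 70).

Let subFD x y : (x, y) \in F -> D x y.
Proof. by case/and3P: Ffac => /subsetP h _ _ /h; rewrite inE. Qed.

Let balF : balanced F. Proof. by case/and3P: Ffac. Qed.

Let connF_sym : connect_sym (arc F).
Proof. exact: balanced_connect_sym. Qed.

Let succF x : exists y, (x, y) \in F.
Proof.
case/and3P: Ffac => _ _ /forallP/(_ x)/card_gt0P[y].
by rewrite inE; exists y.
Qed.

Let predF x : exists y, (y, x) \in F.
Proof.
case/and3P: Ffac => _ /forallP/(_ x)/eqP e /forallP/(_ x).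
by rewrite e => /card_gt0P[y]; rewrite inE; exists y.
Qed.

Let arcF_connect x y : (x, y) \in F -> x ~~> y.
Proof. by move=> h; exact: connect1. Qed.

(** The exchange principle: no out-degree drops, so the updated set is again a factor, and it
    bypasses every removed arc, so it keeps all connections. By maximality the inserted arcs create
    none. *)
Lemma update_connect (M P : {set T * T}) :
  M \subset F -> [disjoint P & F] -> P \subset [set a | D a.1 a.2] ->
  (forall z, outdeg (arc P) z + indeg (arc M) z =
             indeg (arc P) z + outdeg (arc M) z) ->
  (forall z, outdeg (arc M) z <= outdeg (arc P) z) ->
  (forall x y, (x, y) \in M -> connect (arc (F :\: M :|: P)) x y) ->
  forall x y, (x, y) \in P -> x ~~> y.
Proof.
move=> MF PF PD bal leMP Mconn x y xy; set G := F :\: M :|: P in Mconn.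
have GP a b : (a, b) \in P -> (a, b) \in G by rewrite inE => ->; rewrite orbT.
apply: (Fmax (F' := G)); last by apply: connect1; exact: GP.
- apply/and3P; split.
  + apply/subsetP => a; rewrite !inE => /orP[/andP[_]|].
      by move: a => [u w] /subFD.
    by move/(subsetP PD); rewrite inE.
  + exact: balanced_update.
  + apply/forallP => z; have [w /outdeg_gt0 hw] := succF z.
    by move: (outdeg_update z MF PF) (leMP z) hw; rewrite -/G; lia.
- apply: connect_sub => u w uw; case: (boolP ((u, w) \in M)) => [/Mconn//|nM].
  by apply: connect1; rewrite /= !inE nM [(u, w) \in F]uw.
Qed.

(** Rerouting [(x, x')] through [y] would join two components. *)
Lemma no_insertion x x' y :
  (x, x') \in F -> ~~ (x ~~> y) -> D x y -> D y x' -> False.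
Proof.
move=> xx' nxy xy yx'; have nyx' : ~~ (y ~~> x').
  by apply: contra nxy => h; rewrite (connect_trans (arcF_connect xx')) // connF_sym.
have dP : (x, y) != (y, x').
  by apply: contra nxy; rewrite xpair_eqE => /andP[/eqP-> _].
apply/negP: (nxy); rewrite negbK.
apply: (@update_connect [set (x, x')] [set (x, y); (y, x')]); last by rewrite !inE eqxx.
- by rewrite sub1set.
- apply/pred0P => a; rewrite /= !inE; apply/negP => /andP[/orP[]/eqP-> /arcF_connect].
    by rewrite (negbTE nxy).
  by rewrite (negbTE nyx').
- by apply/subsetP => a; rewrite !inE => /orP[]/eqP->.
- move=> z; rewrite outdeg_set2 // indeg_set2 // outdeg_set1 indeg_set1 /=.
  by rewrite -addnA addnC.
- by move=> z; rewrite outdeg_set2 // outdeg_set1 leq_addr.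
- move=> u w; rewrite inE xpair_eqE => /andP[/eqP-> /eqP->].
  by apply: (@connect_trans _ _ y); apply: connect1; rewrite /= !inE eqxx ?orbT.
Qed.

(** A walk stopped at its first visit to [z] cannot meet [x], which does not reach [z]. Such a walk
    survives the removal of arcs leaving [x] or [z]. *)
Lemma connect_avoid x y z : y ~~> z -> ~~ (x ~~> z) ->
  connect [rel a b | [&& (a, b) \in F, a != z & a != x]] y z.
Proof.
move=> yz nxz; case/connectP: yz => p; elim: p y => [|w p IH] y /=.
  by move=> _ ->.
case/andP=> yw pw zl; case: (eqVneq y z) => [->|yz]; first exact: connect0.
apply: connect_trans (IH _ pw zl); apply: connect1; rewrite /= [_ \in F]yw yz /=.
apply: contra nxz => /eqP<-; apply: connect_trans (arcF_connect yw) _.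
by apply/connectP; exists p.
Qed.

(** Replace the two arcs by [(x, y')] and [(y, x')]. A walk from [y'] to [y] survives, by
    [connect_avoid], so [x] still reaches [x'] through it, and [y] reaches [y'] by balance: the swap
    would only merge components. *)
Lemma no_swap x x' y y' :
  (x, x') \in F -> (y, y') \in F -> ~~ (x ~~> y) -> D x y' -> D y x' -> False.
Proof.
move=> xx' yy' nxy xy' yx'.
have [cx cy] := (arcF_connect xx', arcF_connect yy').
have nxy' : ~~ (x ~~> y').
  by apply: contra nxy => h; rewrite (connect_trans h) // connF_sym.
have nyx' : ~~ (y ~~> x').
  by apply: contra nxy => h; rewrite (connect_trans cx) // connF_sym.
have neq_xy : x != y by apply: contra nxy => /eqP->.
have dP : (x, y') != (y, x') by rewrite xpair_eqE (negbTE neq_xy).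
have dM : (x, x') != (y, y') by rewrite xpair_eqE (negbTE neq_xy).
have MF : [set (x, x'); (y, y')] \subset F by rewrite subUset !sub1set xx'.
have PF : [disjoint [set (x, y'); (y, x')] & F].
  apply/pred0P => a; rewrite /= !inE; apply/negP => /andP[/orP[]/eqP-> /arcF_connect].
    by rewrite (negbTE nxy').
  by rewrite (negbTE nyx').
have bal z : outdeg (arc [set (x, y'); (y, x')]) z +
             indeg (arc [set (x, x'); (y, y')]) z =
             indeg (arc [set (x, y'); (y, x')]) z +
             outdeg (arc [set (x, x'); (y, y')]) z.
  by rewrite !outdeg_set2 // !indeg_set2 //= addnC; congr (_ + _); rewrite addnC.
apply/negP: (nxy'); rewrite negbK.
apply: (update_connect MF PF _ bal); last by rewrite !inE eqxx.
- by apply/subsetP => a; rewrite !inE => /orP[]/eqP->.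
- by move=> z; rewrite !outdeg_set2.
set G := _ :\: _ :|: _.
have bG : balanced G by exact: balanced_update.
have xy'G : connect (arc G) x y' by apply: connect1; rewrite /= !inE eqxx !orbT.
have yx'G : connect (arc G) y x' by apply: connect1; rewrite /= !inE eqxx !orbT.
have y'yG : connect (arc G) y' y.
  have := connect_avoid (etrans (connF_sym y' y) cy) nxy.
  apply: connect_sub => a b /and3P[ab ay ax]; apply: connect1.
  by rewrite /= !inE ab !xpair_eqE (negbTE ay) (negbTE ax).
have xx'G := connect_trans xy'G (connect_trans y'yG yx'G).
move=> u w; rewrite !inE !xpair_eqE => /orP[]/andP[/eqP-> /eqP->] //.
by rewrite balanced_connect_sym.
Qed.

Definition cross : rel T := fun x y => D x y && ~~ (x ~~> y).

Arguments cross x y /.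

(** A cycle of arcs between components is balanced and disjoint from [F]; inserting it, with nothing
    removed, would merge components. *)
Lemma cross_acyclic x y : cross x y -> ~~ connect cross y x.
Proof.
move=> xy; apply/negP; case/connectP=> p0 pp0 lp0.
case/shortenP: pp0 lp0 => p pp up _ lp.
have pxy : path cross x (y :: p) by apply/andP.
have lxy : last x (y :: p) = x by [].
have us := walk_arcs_uniq x up.
move: (xy) => /andP[_ /negP]; apply.
apply: (@update_connect set0 [set a in walk_arcs x (y :: p)]).
- exact: sub0set.
- apply/pred0P => -[a b]; rewrite /= !inE; apply/negP => /andP[].
  by case/(mem_walk_arcs pxy) => /andP[_ /negP h] _ _ /arcF_connect.
- apply/subsetP => a; rewrite !inE.
  by case/(mem_walk_arcs pxy) => /andP[].
- move=> z; rewrite (closed_walk_arcs_balanced lxy us) outdegE [X in _ + X = _]indegE.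
  by rewrite !big1 // => u _; rewrite inE.
- by move=> z; rewrite outdegE big1 // => u _; rewrite inE.
- by move=> u w; rewrite inE.
- by rewrite inE /walk_arcs /= mem_head.
Qed.

(** * Direction of the arcs between two components *)

Lemma color_neq x y : D x y -> col x != col y.
Proof. by rewrite -adjE => ->. Qed.

Lemma color_eq x y : ~~ D x y -> ~~ D y x -> col x = col y.
Proof. by move=> h1 h2; apply/eqP; rewrite -[_ == _]negbK -adjE negb_or h1. Qed.

(* Signs of the vertices of a component with respect to [y]: a change from
   [D _ y] to [D y _] must go through a vertex not adjacent to [y]. *)
Lemma sign_change x1 x2 y :
  x1 ~~> x2 -> ~~ (x1 ~~> y) -> D x1 y -> D y x2 ->
  exists x x' x'', [/\ x1 ~~> x, (x, x') \in F /\ (x', x'') \in F,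
                       D x y, col x' = col y & D y x''].
Proof.
move=> x12; case/connectP: x12 => p.
(* The walk is consumed by one or two vertices at a time, hence an induction on a bound of its
   length. *)
have [k] := ubnP (size p); elim: k p x1 => // k IH [|x' p] x1 /=.
  move=> _ _ -> nc xy yx; have c1y : cross x1 y by rewrite /= xy.
  have /negP[] := cross_acyclic c1y.
  by apply: connect1; rewrite /= yx connF_sym.
rewrite ltnS => sp /andP[xx' pp] lp nc xy yx2.
have cx := arcF_connect xx'.
have nc' : ~~ (x' ~~> y) by apply: contra nc; exact: connect_trans.
have wk w : x1 ~~> w -> (exists x x' x'' : T,
    [/\ w ~~> x, (x, x') \in F /\ (x', x'') \in F, D x y, col x' = col y & D y x'']) ->
    exists x x' x'' : T,
    [/\ x1 ~~> x, (x, x') \in F /\ (x', x'') \in F, D x y, col x' = col y & D y x''].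
  by move=> x1w [x [z [z' [wx h1 h2 h3 h4]]]]; exists x, z, z'; split=> //; apply: connect_trans wx.
case: (boolP (D x' y)) => [x'y|nx'y]; first exact: wk cx (IH _ _ sp pp lp nc' x'y yx2).
case: (boolP (D y x')) => [yx'|nyx']; first by case: (no_insertion xx' nc xy yx').
have cc := color_eq nx'y nyx'.
case: p sp pp lp => [|x'' p] /= sp; first by move=> _ e; rewrite -e yx2 in nyx'.
(* [x'] has the colour of [y], so its neighbour [x''] is adjacent to [y]. *)
case/andP=> xx'' pp lp; have : D x'' y || D y x''.
  by rewrite adjE -cc eq_sym color_neq // subFD.
have cx' := connect_trans cx (arcF_connect xx'').
case: (boolP (D y x'')) => [yx'' _|_]; first by exists x1, x', x''; split.
rewrite orbF => x''y; apply: (wk _ cx'); apply: (IH _ _ (ltnW sp) pp lp _ x''y yx2).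
by apply: contra nc; exact: connect_trans cx'.
Qed.

(** Having the colour of [y], the vertex [x'] is adjacent to [z] and [w]; either wrong direction
    would permit a swap, with [(x, x')] and [(z, y)] or with [(x', x'')] and [(y, w)]. *)
Lemma sign_change_swap x x' x'' y z w :
  (x, x') \in F -> (x', x'') \in F -> ~~ (x ~~> y) ->
  D x y -> col x' = col y -> D y x'' -> (z, y) \in F -> (y, w) \in F ->
  D x' z /\ D w x'.
Proof.
move=> xx' xx'' nc xy cc yx'' zy yw; split.
  have : D x' z || D z x'.
    by rewrite adjE cc eq_sym color_neq // subFD.
  case/orP=> // zx'; case: (no_swap xx' zy _ xy zx').
  by apply: contra nc => h; apply: connect_trans h (arcF_connect zy).
have : D w x' || D x' w.
  by rewrite adjE cc eq_sym color_neq // subFD.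
case/orP=> // x'w; case: (no_swap xx'' yw _ x'w yx'').
by apply: contra nc; apply: connect_trans; exact: arcF_connect.
Qed.

(** A sign change at [x'] seen from [y] gives [w -> x' -> z], hence a sign change at some [y'] in
    the component of [y] seen from [x']. Applying [sign_change_swap] to both yields a cycle of arcs
    between the components. *)
Lemma pure_sign x1 x2 y :
  x1 ~~> x2 -> ~~ (x1 ~~> y) -> D x1 y -> D y x2 -> False.
Proof.
move=> x12 nc x1y yx2.
have [x [x' [x'' [x1x [xx' xx''] xy cc yx'']]]] := sign_change x12 nc x1y yx2.
have ncxy : ~~ (x ~~> y) by apply: contra nc; exact: connect_trans.
have [z zy] := predF y; have [w yw] := succF y.
have [x'z wx'] := sign_change_swap xx' xx'' ncxy xy cc yx'' zy yw.
have ncyx' : ~~ (y ~~> x').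
  apply: contra ncxy => h; rewrite (connect_trans (arcF_connect xx')) //.
  by rewrite connF_sym.
have cwy : w ~~> y by rewrite connF_sym arcF_connect.
have cwz : w ~~> z by apply: connect_trans cwy _; rewrite connF_sym arcF_connect.
have nwx' : ~~ (w ~~> x').
  by apply: contra ncyx'; apply: connect_trans; exact: arcF_connect.
have [y1 [y' [y2 [wy1 [yy' yy2] y1x' cc' x'y2]]]] := sign_change cwz nwx' wx' x'z.
have ncy1 : ~~ (y1 ~~> x') by apply: contra nwx'; exact: connect_trans.
have [y'x x''y'] := sign_change_swap yy' yy2 ncy1 y1x' cc' x'y2 xx' xx''.
have cyy' : y ~~> y'.
  apply: connect_trans (arcF_connect yw) (connect_trans wy1 _); exact: arcF_connect.
have cxx'' : x ~~> x''.
  by apply: connect_trans (arcF_connect xx') (arcF_connect xx'').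
have nc1 : ~~ (y ~~> x'').
  by apply: contra ncxy => h; rewrite (connect_trans cxx'') // connF_sym.
have nc2 : ~~ (x'' ~~> y').
  by apply: contra nc1 => h; rewrite (connect_trans cyy') // connF_sym.
have nc3 : ~~ (y' ~~> x).
  by apply: contra ncxy => h; rewrite connF_sym (connect_trans cyy').
have xy_cross : cross x y by rewrite /= xy.
(* The forbidden cycle is [x -> y -> x'' -> y' -> x]. *)
have /negP[] := cross_acyclic xy_cross.
apply: (@connect_trans _ _ x''); first by apply: connect1; rewrite /= yx''.
by apply: (@connect_trans _ _ y'); apply: connect1; rewrite /= ?x''y' ?y'x.
Qed.

(** [x0 -> y] would be an insertion and [y -> x0] contradicts [pure_sign], so [x0] and [y] share a
    colour. The predecessor [x] of [x0] is then adjacent to [y]; by [pure_sign] it precedes [y],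
    which permits a swap. *)
Lemma no_sign_change_arc x0 x1 y y' :
  (y', y) \in F -> x0 ~~> x1 -> ~~ (x0 ~~> y) -> D y' x0 -> D x1 y -> False.
Proof.
move=> y'y c01 nc y'x0 x1y; have nc1 : ~~ (x1 ~~> y).
  by apply: contra nc; exact: connect_trans.
have ncy' : ~~ (y' ~~> x0).
  apply: contra nc => h; rewrite connF_sym in h.
  exact: connect_trans h (arcF_connect y'y).
have nx0y : ~~ D x0 y by apply/negP => h; exact: no_insertion y'y ncy' y'x0 h.
have nyx0 : ~~ D y x0.
  by apply/negP; apply: pure_sign nc1 x1y; rewrite connF_sym.
have cc := color_eq nx0y nyx0; have [x xx0] := predF x0.
have cx1x : x1 ~~> x by rewrite connF_sym (connect_trans (arcF_connect xx0)).
have : D x y || D y x by rewrite adjE -cc color_neq // subFD.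
case/orP=> [xy|yx]; last exact: pure_sign cx1x nc1 x1y yx.
apply: (no_swap xx0 y'y _ xy y'x0); apply: contra ncy' => h.
by rewrite connF_sym in h; exact: connect_trans h (arcF_connect xx0).
Qed.

(** [x] and its successor in [F] have different colours, so one of them differs in colour from
    [y]. *)
Lemma adjacent_to_component x y :
  exists2 x', x ~~> x' & D x' y || D y x'.
Proof.
case: (boolP (D x y || D y x)) => [h|]; first by exists x.
rewrite adjE negbK => /eqP cc; have [x' xx'] := succF x.
exists x'; first exact: arcF_connect.
by rewrite adjE -cc eq_sym color_neq // subFD.
Qed.

(** An arc back from [y2] propagates along a walk of [F] from [y2] to [y]: by [no_sign_change_arc]
    each next vertex also sends an arc to the component of [x]. At [y] this contradicts
    [pure_sign]. *)
Lemma component_dominates x y x2 y2 :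
  D x y -> ~~ (x ~~> y) -> x ~~> x2 -> y ~~> y2 -> ~~ D y2 x2.
Proof.
move=> xy nc xx2 yy2; apply/negP => yx2; rewrite connF_sym in yy2.
case/connectP: yy2 => p.
elim: p y2 x2 xx2 yx2 => [|z p IH] y2 x2 xx2 yx2 /=.
  by move=> _ yE; rewrite -yE in yx2; exact: pure_sign xx2 nc xy yx2.
case/andP=> yz pz yl; have [x' xx' /orP[x'z|zx']] := adjacent_to_component x z.
  apply: (no_sign_change_arc yz _ _ yx2 x'z).
    by apply: connect_trans xx'; rewrite connF_sym.
  apply: contra nc => h; apply: connect_trans xx2 (connect_trans h _).
  by apply/connectP; exists p.
exact: IH xx' zx' pz yl.
Qed.

(** If [F] were disconnected, strength would give an arc leaving the component of any [z]. As [z] is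
    adjacent to the component entered, domination gives [z] itself an outgoing cross arc. *)
Lemma max_connected_connected : strong D -> forall x y, x ~~> y.
Proof.
move=> sD.
have out_cross u v z : ~~ (u ~~> v) -> exists w, cross z w.
  move=> nuv; have [v' nzv'] : exists v', ~~ (z ~~> v').
    case: (boolP (z ~~> v)) => zv; last by exists v.
    exists u; apply: contra nuv => zu; apply: connect_trans zv.
    by rewrite connF_sym.
  have [a [b [za nzb ab]]] := connect_exit (sD z v') (connect0 (arc F) z) nzv'.
  have nab : ~~ (a ~~> b) by apply: contra nzb; exact: connect_trans.
  have caz : a ~~> z by rewrite connF_sym.
  have [w bw adj] := adjacent_to_component b z.
  have /negPf nwz := component_dominates ab nab caz bw.
  exists w; move: adj; rewrite nwz /= => ->; apply: contra nzb => zw.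
  by apply: connect_trans zw _; rewrite connF_sym.
move=> u v; apply: contraT => nuv.
(* Passing to a cross successor strictly shrinks the set reachable by cross arcs, so a vertex with
   the smallest such set is absurd. *)
case: (arg_minnP (fun z => #|connect cross z|) (erefl : xpredT u)) => z _ zmin.
have [w zw] := out_cross u v z nuv.
suff : connect cross w \proper connect cross z.
  by move/proper_card; rewrite ltnNge zmin.
apply/properP; split.
  by apply/subsetP => t; apply: connect_trans; exact: connect1.
by exists z; [exact: connect0 | exact: cross_acyclic].
Qed.

End Merge.

(* Every vertex [w] is split into an entry [(w, false)] and an exit
   [(w, true)]; a step inside [w] changes the flow through [w], which must not
   drop to zero. *)
Definition residual (T : finType) (D : rel T) (F : {set T * T}) : rel (T * bool) :=
  fun a b => match a, b with
  | (u, true), (w, false) =>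
      if u == w then 1 < outdeg (arc F) u else D u w && ((u, w) \notin F)
  | (w, false), (u, true) => (u == w) || ((u, w) \in F)
  | _, _ => false
  end.

(** * Augmentation along a residual cycle *)

Section Augment.
Variables (T : finType) (D : rel T) (F : {set T * T}).
Hypotheses (FD : F \subset [set a | D a.1 a.2]) (balF : balanced F).
Variable c : seq (T * bool).
Hypotheses (cyc : cycle (residual D F) c) (uc : uniq c).

Let step : rel (T * bool) := fun a b => (a \in c) && (next c a == b).

Let stepE a b : step a b = (b \in c) && (prev c b == a).
Proof.
apply/andP/andP => -[h /eqP<-]; first by rewrite mem_next prev_next.
by rewrite mem_prev next_prev.
Qed.

Let step_residual a b : step a b -> residual D F a b.
Proof. by case/andP=> ac /eqP<-; exact: next_cycle. Qed.

(** Exit-to-entry steps of the cycle insert arcs, entry-to-exit steps remove them; steps within one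
    vertex are set aside. *)
Let gain := [set a : T * T | (a.1 != a.2) && step (a.1, true) (a.2, false)].
Let loss := [set a : T * T | (a.1 != a.2) && step (a.2, false) (a.1, true)].

Let sum_eq_op (x : T) : \sum_y (x == y) = 1.
Proof.
rewrite (bigD1 x) //= eqxx big1 ?addn0 // => y yx.
by rewrite eq_sym (negbTE yx).
Qed.

(** Residual arcs alternate between exits and entries, so the successor of [a] occurs among the
    summands. *)
Let sum_next (a : T * bool) : \sum_w step a (w, ~~ a.2) = (a \in c).
Proof.
case: (boolP (a \in c)) => ac; last by rewrite big1 // => w _; rewrite /step (negbTE ac).
have := next_cycle cyc ac; case E : (next c a) => [w b] r.
have -> : ~~ a.2 = b by case: a b {ac E} r => [u []] [].
rewrite -[RHS](sum_eq_op w); apply: eq_bigr => y _.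
by rewrite /step ac E xpair_eqE eqxx andbT.
Qed.

Let sum_prev (b : T * bool) : \sum_u step (u, ~~ b.2) b = (b \in c).
Proof.
case: (boolP (b \in c)) => bc; last by rewrite big1 // => w _; rewrite stepE (negbTE bc).
have := prev_cycle cyc bc; case E : (prev c b) => [u d] r.
have -> : ~~ b.2 = d by case: b d {bc E} r => [w []] [].
rewrite -[RHS](sum_eq_op u); apply: eq_bigr => y _.
by rewrite stepE bc E xpair_eqE eqxx andbT.
Qed.

Let split_diag (f : T -> bool) x : \sum_y ((x != y) && f y) + f x = \sum_y f y.
Proof.
rewrite (bigD1 x) //= [RHS](bigD1 x) //= eqxx /= add0n addnC; congr (_ + _).
by apply: eq_bigr => y; rewrite eq_sym => ->.
Qed.

(** Here and in the next three identities, the unique cycle neighbour of a copy of a vertex accounts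
    for a changed arc or for the inner step. *)
Let out_gain u : outdeg (arc gain) u + step (u, true) (u, false) = ((u, true) \in c).
Proof.
rewrite -sum_next -(split_diag _ u) outdegE; congr (_ + _).
by apply: eq_bigr => w _; rewrite inE.
Qed.

Let in_gain w : indeg (arc gain) w + step (w, true) (w, false) = ((w, false) \in c).
Proof.
rewrite -sum_prev -(split_diag _ w) indegE; congr (_ + _).
by apply: eq_bigr => u _; rewrite inE eq_sym.
Qed.

Let out_loss u : outdeg (arc loss) u + step (u, false) (u, true) = ((u, true) \in c).
Proof.
rewrite -sum_prev -(split_diag _ u) outdegE; congr (_ + _).
by apply: eq_bigr => w _; rewrite inE.
Qed.

Let in_loss w : indeg (arc loss) w + step (w, false) (w, true) = ((w, false) \in c).
Proof.
rewrite -sum_next -(split_diag _ w) indegE; congr (_ + _).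
by apply: eq_bigr => u _; rewrite inE eq_sym.
Qed.

(** An inner step from entry to exit raises the out-degree by one, as at [v]; the opposite step
    lowers it by one, but only where it exceeds 1. *)
Lemma augment v : outdeg (arc F) v = 0 -> (v, false) \in c ->
  next c (v, false) = (v, true) ->
  exists G : {set T * T},
    [/\ G \subset [set a | D a.1 a.2], balanced G, 0 < outdeg (arc G) v &
        forall u, 0 < outdeg (arc F) u -> 0 < outdeg (arc G) u].
Proof.
move=> v0 vc vn.
have lossF : loss \subset F.
  apply/subsetP => -[u w]; rewrite inE /= => /andP[uw /step_residual].
  by rewrite /= (negbTE uw).
have gainD u w : (u, w) \in gain -> D u w && ((u, w) \notin F).
  by rewrite inE /= => /andP[uw /step_residual]; rewrite /= (negbTE uw).
have gainF : [disjoint gain & F].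
  apply/pred0P => -[u w] /=; apply/negP => /andP[/gainD/andP[_ /negP]].
  by move=> h /h.
have cap u : step (u, true) (u, false) -> 1 < outdeg (arc F) u.
  by move/step_residual; rewrite /= eqxx.
exists (F :\: loss :|: gain); split.
- apply/subsetP => -[u w]; rewrite 2!inE => /orP[|/gainD/andP[]]; last by rewrite inE.
  by rewrite inE => /andP[_ /(subsetP FD)].
- apply: balanced_update => // x.
  move: (out_gain x) (in_gain x) (out_loss x) (in_loss x).
  move: (nat_of_bool _) (nat_of_bool _) (nat_of_bool _) (nat_of_bool _) => ? ? ? ?.
  by move: (outdeg _ x) (indeg _ x) (outdeg _ x) (indeg _ x); clear; lia.
- move: (outdeg_update v lossF gainF) (out_gain v) (out_loss v).
  rewrite v0; have -> : step (v, false) (v, true) by rewrite /step vc vn eqxx.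
  have -> : step (v, true) (v, false) = false.
    by apply/negP => /cap; rewrite v0.
  rewrite add0n addn0 addn1 => e1 e2 e3; rewrite -(ltn_add2r (outdeg (arc loss) v)).
  by rewrite e1 e2 -e3.
- move=> u u0; move: (outdeg_update u lossF gainF) (out_gain u) (out_loss u).
  move: (outdeg (arc gain) u) (outdeg (arc loss) u) => g l.
  move: (nat_of_bool ((u, true) \in c)) (nat_of_bool (step (u, false) (u, true))) => k k'.
  by case: (boolP (step (u, true) (u, false))) => [/cap|_]; move: u0; clear; lia.
Qed.

End Augment.

(** * Excluding a cut in the residual network *)

Section Cut.
Variables (T : finType) (D : rel T) (col : T -> {set T}).
Hypothesis adjE : forall x y, D x y || D y x = (col x != col y).
Hypothesis sD : strong D.
Hypothesis degD : forall u v : T, dominated D u v -> nonadjacent D u v ->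
  2 * #|T| - 3 <= deg D u + deg D v.
Variable F : {set T * T}.
Hypothesis balF : balanced F.
(** [up] and [lo] stand for the vertices whose exit, respectively entry, is residually reachable
    from the exit of [v]; the hypotheses express closure under residual arcs. *)
Variables up lo : pred T.
Hypothesis lo_up : forall w, lo w -> up w.
Hypothesis up_lo : forall u w, up u -> D u w -> (u, w) \notin F -> lo w.
Hypothesis lo_F : forall u w, lo w -> (u, w) \in F -> up u.
Hypothesis cut_le1 : forall w, up w -> ~~ lo w -> outdeg (arc F) w <= 1.
Variable v : T.
Hypotheses (upv : up v) (nlov : ~~ lo v) (v0 : outdeg (arc F) v = 0).

Let in_out x : indeg (arc F) x = outdeg (arc F) x.
Proof. by apply/esym/eqP; move/forallP: balF. Qed.

Let B := [set w | up w && ~~ lo w].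
Let E := [set a in F | up a.1 && ~~ lo a.2].

Let mem_E u w : up u -> ~~ lo w -> D u w -> (u, w) \in E.
Proof.
move=> uu lw uw; rewrite !inE uu lw !andbT.
by apply: contraR lw; exact: up_lo.
Qed.

(** Arcs of [F] leaving [up] are those of [E] and those entering [lo]. By balance [E] has as many
    arcs as the out-degrees over [B] sum to: 0 at [v], at most 1 elsewhere. *)
Let card_E : #|E| <= #|B :\ v|.
Proof.
pose U := [set w | up w]; pose L := [set w | lo w].
have sumU : \sum_(x in U) outdeg (arc F) x =
    \sum_(x in B) outdeg (arc F) x + \sum_(x in L) outdeg (arc F) x.
  rewrite (bigID lo) /= addnC; congr (_ + _); apply: eq_bigl => x.
    by rewrite !inE.
  by rewrite !inE andb_idl //; exact: lo_up.
have sumL : \sum_(x in L) outdeg (arc F) x = \sum_(x in L) indeg (arc F) x.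
  by apply: eq_bigr => x _; rewrite in_out.
have splitU : #|[set a in F | a.1 \in U]| = #|E| + #|[set a in F | a.2 \in L]|.
  rewrite -(cardsID [set a in F | a.2 \in L] [set a in F | a.1 \in U]) addnC.
  congr (_ + _); apply: eq_card => -[a b]; rewrite !inE /=.
    by case: (_ \in F) (up a) (lo b) => [] [] [].
  case: (boolP (_ \in F)) => //= ab; case: (boolP (lo b)) => lb; rewrite ?andbF //.
  by rewrite (lo_F lb ab).
move: sumU; rewrite sumL sum_outdeg sum_indeg splitU => /addIn ->.
rewrite (bigD1 v) /=; last by rewrite inE upv.
rewrite v0 add0n -sum1_card.
rewrite (eq_bigl (mem (B :\ v))) => [|x]; last by rewrite !inE andbC.
by apply: leq_sum => x; rewrite !inE => /and3P[_ ? ?]; exact: cut_le1.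
Qed.

Let v_out w : D v w -> lo w.
Proof.
move=> vw; apply: contraT => lw; have := mem_E upv lw vw.
by rewrite inE => /andP[/outdeg_gt0]; rewrite v0.
Qed.

Let v_in w : D w v -> ~~ up w.
Proof.
move=> wv; apply/negP => uw; have := mem_E uw nlov wv.
by rewrite inE => /andP[/indeg_gt0]; rewrite in_out v0.
Qed.

(** By [v_in] and [v_out], [b] is not adjacent to [v]. *)
Let colB b : b \in B -> col b = col v.
Proof.
rewrite inE => /andP[ub lb]; apply/eqP; rewrite -[_ == _]negbK -adjE negb_or.
apply/andP; split; first by apply: contraL ub; exact: v_in.
by apply: contra lb; exact: v_out.
Qed.

(** Each vertex of [B] other than [v] is the tail of an arc of [E]. Strength adds one with its tail
    in [lo], too many for [card_E]. *)
Let out_saturated w : D v w ->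
  (forall b, b \in B :\ v -> exists2 x, D b x & ~~ lo x) -> False.
Proof.
move=> vw h; have [a [b [la lb ab]]] := connect_exit (sD _ _) (v_out vw) nlov.
have abE := mem_E (lo_up la) lb ab.
have: B :\ v \subset [set e.1 | e in E :\ (a, b)].
  apply/subsetP => x xB; have [y xy ly] := h x xB.
  move: (xB); rewrite !inE => /and3P[_ ux lx].
  apply/imsetP; exists (x, y) => //; rewrite in_setD1 mem_E // andbT.
  by rewrite xpair_eqE negb_and; apply/orP; left; apply: contraNneq lx => ->.
move/subset_leq_card => h1; have h2 := leq_trans h1 (leq_imset_card _ _).
have := leq_trans card_E h2.
by rewrite (cardsD1 (a, b) E) abE add1n ltnn.
Qed.

Lemma cut_impossible : 1 < #|T| -> False.
Proof.
move=> n1.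
have [z zv] : exists z, z != v.
  apply/existsP; rewrite -[X in is_true X]negbK negb_exists; apply/negP => /forallP h.
  move: n1; rewrite -cardsT (_ : setT = [set v]) ?cards1 //.
  by apply/setP => x; rewrite !inE; have := h x; rewrite negbK => ->.
have [w vw] : exists w, D v w.
  case/connectP: (sD v z) => -[/= _ e|w p /= /andP[vw _] _]; last by exists w.
  by rewrite e eqxx in zv.
have [a av] : exists a, D a v.
  case/connectP: (sD z v) => p; case/lastP: p => [/= _ e|p x].
    by rewrite e eqxx in zv.
  by rewrite rcons_path last_rcons => /andP[_ h] ->; exists (last z p).
have nua := v_in av; have nla : ~~ lo a by apply: contra nua; exact: lo_up.
have ca : col a != col v by rewrite -adjE av.
(* If [a] dominates no other vertex of [B], all of them send arcs to [a], which lies outside [lo].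
   Otherwise the degree condition applies to [v] and [b]. *)
case: (boolP [exists b in B :\ v, D a b]) => [/exists_inP[b bBv ab]|]; last first.
  rewrite negb_exists_in => /forall_inP h; apply: out_saturated vw _ => b bB.
  exists a => //; move: (h b bB) (bB); rewrite in_setD1 => nab /andP[_ /colB cb].
  by move: ca; rewrite -cb -adjE (negbTE nab).
have [bv bB] : b != v /\ b \in B by apply/andP; rewrite -in_setD1.
have cb := colB bB; move: (bB); rewrite inE => /andP[ub lb].
have nadj x y : col x = col y -> ~~ D x y.
  by move=> e; apply/negP => xy; have := adjE x y; rewrite xy e eqxx.
have deg_vb : 2 * #|T| - 3 <= deg D v + deg D b.
  by apply: degD; [exists a | split; rewrite ?nadj // eq_sym].
(* [Q] is the complement of the part of [v]; [eo] and [ei] collect the neighbours of [b] on the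
   wrong side of the cut, at most one each because their arcs belong to [F]. *)
pose Q := [set x | col x != col v]; pose L := [set x | lo x].
pose eo := [set x | D b x && ~~ lo x]; pose ei := [set x | D x b && up x].
have Qadj x y : col y = col v -> D x y || D y x -> x \in Q.
  by move=> e; rewrite inE -e adjE.
have ov : outdeg D v <= #|Q :&: L|.
  apply: subset_leq_card; apply/subsetP => x; rewrite inE => vx.
  by rewrite in_setI (Qadj x v) ?vx ?orbT // inE v_out.
have iv : indeg D v <= #|Q :\: L|.
  apply: subset_leq_card; apply/subsetP => x; rewrite inE => xv.
  rewrite in_setD (Qadj x v) ?xv // inE andbT.
  by apply: contra (v_in xv); exact: lo_up.
have ob : outdeg D b <= #|Q :&: L| + #|eo|.
  apply: leq_trans (leq_card_setU _ _); apply: subset_leq_card.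
  apply/subsetP => x; rewrite !inE => bx; rewrite bx -cb -adjE bx orbT /=.
  by case: (lo x).
have ib : indeg D b <= #|Q :\: L| + #|ei|.
  apply: leq_trans (leq_card_setU _ _); apply: subset_leq_card.
  apply/subsetP => x; rewrite !inE => xb; rewrite xb -cb -adjE xb /= andbT.
  by case: (boolP (lo x)) => // /lo_up ->.
have eo1 : #|eo| <= 1.
  apply: leq_trans (cut_le1 ub lb); apply: subset_leq_card; apply/subsetP => x.
  by rewrite !inE => /andP[bx lx]; have := mem_E ub lx bx; rewrite inE => /andP[].
have ei1 : #|ei| <= 1.
  apply: leq_trans (cut_le1 ub lb); rewrite -in_out.
  apply: subset_leq_card; apply/subsetP => x.
  by rewrite !inE => /andP[xb ux]; have := mem_E ux lb xb; rewrite inE => /andP[].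
have QL := cardsID L Q; have QC := cardsC Q.
have vQ : v \in ~: Q by rewrite !inE eqxx.
have bQ : b \in (~: Q) :\ v by rewrite !inE bv cb eqxx.
have QC2 : #|~: Q| = 2 + #|(~: Q) :\ v :\ b|.
  by rewrite (cardsD1 v) vQ (cardsD1 b) bQ.
have BQ : #|B :\ v :\ b| <= #|(~: Q) :\ v :\ b|.
  apply: subset_leq_card; do 2!apply: setSD; apply/subsetP => x /colB cx.
  by rewrite !inE cx eqxx.
have Bv : #|B :\ v| = 1 + #|B :\ v :\ b| by rewrite (cardsD1 b) bBv.
have [B0 e0] : #|B :\ v :\ b| = 0 /\ (0 < #|eo|) || (0 < #|ei|).
  move: (#|eo|) (#|ei|) eo1 ei1 ob ib => o i o1 i1 ob ib.
  (* With [m] further vertices in the part of [v], the order is [#|Q| + 2 + m], while the two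
     degrees sum to at most [2 * #|Q| + o + i]. As [o + i] is at most 2, [m = 0]. *)
  have eoi : 1 + 2 * #|(~: Q) :\ v :\ b| <= o + i.
    move: deg_vb ov iv ob ib QL QC; rewrite QC2 /deg.
    move: (outdeg D v) (indeg D v) (outdeg D b) (indeg D b) #|T|.
    move: #|Q :&: L| #|Q :\: L| #|Q| #|_ :\ b|; clear; lia.
  move: BQ eoi; move: #|_ :\ b| #|_ :\ b| => m k.
  by move: o1 i1; clear; case: o i => [|o] [|i]; split=> //; lia.
(* Now [b] is the only vertex of [B] besides [v]; an arc counted by [eo] saturates it. *)
case/orP: e0 => /card_gt0P[x]; rewrite inE => /andP[bx h].
  apply: out_saturated vw _ => y yB; exists x => //.
  have : y \notin B :\ v :\ b by rewrite (cards0_eq B0) inE.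
  by rewrite in_setD1 yB andbT negbK => /eqP->.
(* If [ei] is nonempty, the arc into [b] and an arc leaving [up] are two elements of [E], where
   [card_E] allows one. *)
have [u [t [uu ut utD]]] := connect_exit (sD _ _) upv nua.
have lt : ~~ lo t by apply: contra ut; exact: lo_up.
have xbE := mem_E h lb bx; have utE := mem_E uu lt utD.
have : [set (x, b); (u, t)] \subset E by rewrite subUset !sub1set xbE.
move/subset_leq_card; rewrite cards2 xpair_eqE.
have -> : (b == t) = false by apply: contraNF ut => /eqP<-.
by rewrite andbF /= => h1; have := leq_trans h1 card_E; rewrite Bv B0.
Qed.

End Cut.

(** * Existence of an eulerian factor, and the conclusion *)

Lemma eulerian_factor_exists (T : finType) (D : rel T) (col : T -> {set T}) :
  1 < #|T| -> irreflexive D -> strong D ->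
  (forall x y, D x y || D y x = (col x != col y)) ->
  (forall u v : T, dominated D u v -> nonadjacent D u v ->
    2 * #|T| - 3 <= deg D u + deg D v) ->
  exists F, eulerian_factor D F.
Proof.
move=> n1 irD sD adjE degD.
pose ok (F : {set T * T}) := (F \subset [set a | D a.1 a.2]) && balanced F.
pose covered (F : {set T * T}) := [set x | 0 < outdeg (arc F) x].
have ok0 : ok set0.
  rewrite /ok sub0set; apply/forallP => x; rewrite outdegE indegE.
  by rewrite !big1 // => y _; rewrite inE.
case: (arg_maxnP (fun F => #|covered F|) ok0) => F /andP[FD bF] Fmax.
exists F; apply/and3P; split=> //; apply/forallP => v.
rewrite lt0n; apply/negP => /eqP v0.
pose r := residual D F.
case: (boolP (connect r (v, true) (v, false))) => [|nr].
  case/connectP=> p0 pp0 lp0; case/shortenP: pp0 lp0 => p pp up _ lp.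
  have cyc : cycle r ((v, true) :: p).
    by rewrite /cycle rcons_path pp -lp /= eqxx.
  have vp : (v, false) \in (v, true) :: p by rewrite lp mem_last.
  (* [(v, false)] comes last, so its index is out of range in [p] and [nth] returns its default, the
     head of the cycle. *)
  have vn : next ((v, true) :: p) (v, false) = (v, true).
    by rewrite next_nth vp lp index_last // nth_default.
  have [G [GD bG vG covG]] := augment FD bF cyc up v0 vp vn.
  have := Fmax G; rewrite /ok GD bG => /(_ isT) /=.
  apply/negP; rewrite -ltnNge; apply: proper_card; apply/properP; split.
    by apply/subsetP => u; rewrite !inE; exact: covG.
  by exists v; rewrite inE ?vG // v0.
apply: (@cut_impossible _ _ _ adjE sD degD F bF
  (fun w => connect r (v, true) (w, true)) (fun w => connect r (v, true) (w, false))
  _ _ _ _ v _ nr v0 n1); last exact: connect0.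
- by move=> w h; apply: connect_trans h (connect1 _); rewrite /= eqxx.
- move=> u w h uw nF; apply: connect_trans h (connect1 _); rewrite /= uw nF.
  (* Looplessness excludes [u = w], which [residual] reads as an inner step. *)
  by case: eqP => // e; rewrite e irD in uw.
- by move=> u w h uw; apply: connect_trans h (connect1 _); rewrite /= uw orbT.
- move=> w h; apply: contraR; rewrite -ltnNge => h2.
  by apply: connect_trans h (connect1 _); rewrite /= eqxx.
Qed.

Theorem theorem2 (T : finType) (D : rel T)
  (hT : 0 < #|T|)
  (hloopless : irreflexive D)
  (hstrong : strong D)
  (hsmd : semicomplete_multipartite D)
  (hdeg : forall u v : T, dominated D u v -> nonadjacent D u v ->
            2 * #|T| - 3 <= deg D u + deg D v) :
  supereulerian D.
Proof.
have [G [[P [_ GE]] DG]] := hsmd.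
have adjE x y : D x y || D y x = (pblock P x != pblock P y) by rewrite DG GE.
case: (ltnP 1 #|T|) => n1; last first.
  (* A single vertex is covered by the trivial walk. *)
  have /card_le1_eqP T1 := n1; have [x _] := card_gt0P hT.
  exists x, [::]; split; first by split.
  by move=> v; rewrite inE (T1 v x).
have [F Ffac Fmax] :=
  max_connected_exists (eulerian_factor_exists n1 hloopless hstrong adjE hdeg).
have /and3P[/subsetP FD bF _] := Ffac; have [x _] := card_gt0P hT.
have [p [[px lx up] cov]] := balanced_connected_trail x bF
  (max_connected_connected adjE Ffac Fmax hstrong).
exists x, p; split=> //; split=> //; apply: sub_path px => u w /FD.
by rewrite inE.
Qed.
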